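(* Let $n,\delta,r\in\mathbb{N}$ with $\delta\geq 3$, $r\geq 1$ and $n\geq 6$. If $G$ is a connected triangle-free graph of order $n$, minimum degree $\delta$ and radius $r$, then \[\pi(G)\geq \frac{\delta}{2(n-1)}\left[r^2-7r+\frac{47}{8}\right].\] Moreover, for constant $\delta$ this bound is sharp apart from an additive constant.
   Context: All graphs are finite and simple. For a connected graph $G$ of order $n\ge 2$ and a vertex $v$, $\overline{\sigma}(v)=\frac{1}{n-1}\sum_{w\in V(G)}d(v,w)$, where $d$ is the shortest-path distance, and the proximity is $\pi(G)=\min_{v\in V(G)}\overline{\sigma}(v)$. The eccentricity of $v$ is the maximum distance from $v$ to another vertex, and the radius is the minimum eccentricity. Triangle-free means no $K_3$ subgraph. ''Sharp apart from an additive constant'' means that there is an absolute constant $c$ such that for every fixed $\delta\ge3$ there are connected triangle-free graphs of minimum degree $\delta$, radius $r$ and order $n$ (for arbitrarily large $r$ and $n$) whose proximity exceeds the bound by at most $c$. *)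

(* Defs.v *)
From HB Require Import structures.
From mathcomp Require Import all_boot all_order all_algebra.

Set Implicit Arguments.
Unset Strict Implicit.
Unset Printing Implicit Defensive.

Import Order.TTheory GRing.Theory Num.Theory.

Record sgraph := SGraph {
  vertex :> finType;
  adj : rel vertex;
  adj_sym : symmetric adj;
  adj_irr : irreflexive adj }.

(* The minimum of [f] over [T]; the value [x0] is only used if [T] is empty. *)
Definition fmin d (R : orderType d) (x0 : R) (T : finType) (f : T -> R) : R :=
  if [pick v : T] is Some v0 then f [arg min_(v < v0) f v]%O else x0.

Lemma fmin_le d (R : orderType d) (x0 : R) (T : finType) (f : T -> R) v :
  (fmin x0 f <= f v)%O.
Proof.
rewrite /fmin; case: pickP => [v0 _|/(_ v)//].
by case: Order.TotalTheory.arg_minP => // i _; apply.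
Qed.

Lemma fmin_attained d (R : orderType d) (x0 : R) (T : finType) (f : T -> R) :
  0 < #|T| -> exists v, f v = fmin x0 f.
Proof.
case/card_gt0P => v _; rewrite /fmin; case: pickP => [v0 _|/(_ v)//].
by eexists.
Qed.

Section Graph.
Variable G : sgraph.
Implicit Types (u v w : G) (k : nat).

Definition connected := forall u v, connect (@adj G) u v.

Definition triangle_free :=
  forall u v w, ~~ [&& adj u v, adj v w & adj w u].

Definition degree v := #|[set w | adj v w]|.

Definition min_degree : nat := fmin 0 degree.

Definition walk_of_length k u v :=
  [exists p : k.-tuple G, path (@adj G) u p && (last u p == v)].

(* A shortest walk repeats no vertex, so lengths below [#|G|] suffice; the
   value is [#|G|] if [v] is not reachable from [u]. *)
Definition dist u v : nat :=
  find (fun k => walk_of_length k u v) (iota 0 #|G|).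

Lemma walk_of_lengthP k u v :
  reflect (exists p, [/\ path (@adj G) u p, last u p = v & size p = k])
          (walk_of_length k u v).
Proof.
apply: (iffP existsP) => [[p /andP[up /eqP lp]]|[p [up lp <-]]].
  by exists p; rewrite size_tuple.
by exists (in_tuple p); rewrite /= up lp eqxx.
Qed.

Lemma dist_min p u : path (@adj G) u p -> dist u (last u p) <= size p.
Proof.
move=> up; rewrite leqNgt; apply/negP => lt_p; have := lt_p.
have lt_G : size p < #|G|.
  by apply: leq_trans lt_p _; rewrite -[X in _ <= X](size_iota 0) find_size.
move/(before_find 0); rewrite nth_iota // add0n => /negbT/negP; apply.
by apply/walk_of_lengthP; exists p.
Qed.

Lemma dist_attained u v : connect (@adj G) u v ->
  exists p, [/\ path (@adj G) u p, last u p = v & size p = dist u v].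
Proof.
case/connectP => p0 /shortenP[p up uniq_p _] ->{v}.
apply/walk_of_lengthP.
have lt_p : size p < #|G| by move/card_uniqP: uniq_p => /= <-; apply: max_card.
have h : has (fun k => walk_of_length k u (last u p)) (iota 0 #|G|).
  apply/hasP; exists (size p); first by rewrite mem_iota.
  by apply/walk_of_lengthP; exists p.
have := nth_find 0 h; rewrite nth_iota //.
by rewrite -[X in _ < X](size_iota 0) -has_find.
Qed.

Definition eccentricity v : nat := \max_(w : G) dist v w.

Definition radius : nat := fmin 0 eccentricity.

Local Open Scope ring_scope.

Definition avg_dist v : rat := (\sum_(w : G) dist v w)%N%:R / (#|G|%:R - 1).

Definition proximity : rat := fmin 0 avg_dist.

End Graph.

Definition proximity_bound (n delta r : nat) : rat :=
  (delta%:R / (2 * (n%:R - 1)) * (r%:R ^+ 2 - 7 * r%:R + 47 / 8))%R.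

(* Main.v *)
(* Lower bound.  If the vertices in U have pairwise disjoint neighbourhoods, then
   sum_w d(v,w) >= delta * sum_(u in U) (d(v,u) - 1), because a neighbour of u is
   at distance at least d(v,u) - 1 from v.  Let v attain the proximity, let P be
   a geodesic from v to a vertex at maximum distance d = r + s, and let Q be a
   geodesic, of length e, from v to a vertex at distance at least r from p_(s+5).
   Counting back from the far end, two consecutive vertices out of every four on
   P qualify for U (consecutive ones because there are no triangles).  From level
   s + 7 on, the vertices of Q are at distance more than 2 from P, since otherwise
   p_(s+5) would be too close to the end of Q; so there the corresponding vertices
   of Q can be added.  The resulting quadratic estimate suffices for r >= 15; for
   r <= 14 the geodesic P alone is enough.

   Sharpness.  Blow up the cycle C_4k into independent sets of sizes
   1, 1, delta-1, delta-1, 1, 1, ...  The result is delta-regular and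
   triangle-free, has radius 2k and order 2k*delta, and a vertex in a class of
   size 1 has total distance about 2*delta*k^2. *)

Require Import Defs.
From HB Require Import structures.
From mathcomp Require Import all_boot all_order all_algebra.
From mathcomp Require Import zify ring lra.

Set Implicit Arguments.
Unset Strict Implicit.
Unset Printing Implicit Defensive.

Import Order.TTheory GRing.Theory Num.Theory.

(** * Distances and geodesics *)

Lemma dist_adj (G : sgraph) (u v : G) : adj u v -> dist u v <= 1.
Proof. by move=> uv; apply: (@dist_min G [:: v]); rewrite /= uv. Qed.

Lemma dist_refl (G : sgraph) (u : G) : dist u u = 0.
Proof. by apply/eqP; rewrite -leqn0; apply: (@dist_min G [::]). Qed.

Section Distance.
Variables (G : sgraph) (G_conn : connected G).
Implicit Types u v w : G.

Lemma dist_triangle u v w : dist u w <= dist u v + dist v w.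
Proof.
have [p [up <- <-]] := dist_attained (G_conn u v).
have [q [uq <- <-]] := dist_attained (G_conn (last u p) w).
by rewrite -size_cat -last_cat; apply: dist_min; rewrite cat_path up.
Qed.

Lemma dist_path (p : nat -> G) d : (forall i, i < d -> adj (p i) (p i.+1)) ->
  forall i k, i + k <= d -> dist (p i) (p (i + k)) <= k.
Proof.
move=> p_adj i; elim=> [|k IH] le_d; first by rewrite addn0 dist_refl.
apply: leq_trans (dist_triangle _ (p (i + k)) _) _.
by rewrite -[k.+1]addn1 leq_add ?IH ?addn1 ?addnS ?dist_adj ?p_adj //; lia.
Qed.

Lemma dist_sym u v : dist u v = dist v u.
Proof.
wlog: u v / dist v u <= dist u v => [hwlog|le_vu].
  by case/orP: (leq_total (dist v u) (dist u v)) => /hwlog.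
apply/eqP; rewrite eqn_leq le_vu andbT.
have [p [vp <- <-]] := dist_attained (G_conn v u).
have lastE : last (last v p) (rev (belast v p)) = v.
  by case: p {vp} => //= a p; rewrite rev_cons last_rcons.
rewrite -[X in dist _ X]lastE -[size p](size_belast v) -size_rev.
apply: dist_min.
by rewrite rev_path (eq_path (e' := @adj G)) // => a b; rewrite adj_sym.
Qed.

(** Indexing by [nat] makes levels plain numbers; values of [p] beyond [dist u v] are irrelevant. A
    shortcut to some [p i] would also shorten the walk to [v]. *)
Lemma geodesic u v : exists p : nat -> G,
  [/\ p 0 = u, p (dist u v) = v,
      forall i, i < dist u v -> adj (p i) (p i.+1) &
      forall i, i <= dist u v -> dist u (p i) = i].
Proof.
have [s [us sv s_size]] := dist_attained (G_conn u v).
pose p i := nth u (u :: s) i.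
have p_adj i : i < dist u v -> adj (p i) (p i.+1).
  by rewrite -s_size => lt_i; apply: (pathP u us).
have pv : p (dist u v) = v by rewrite /p -s_size -last_nth.
exists p; split=> // i le_i; apply/eqP; rewrite eqn_leq; apply/andP; split.
  exact: (@dist_path p _ p_adj 0 i).
have := dist_triangle u (p i) v.
have := dist_path p_adj (i := i) (k := dist u v - i).
rewrite subnKC // pv => /(_ (leqnn _)); lia.
Qed.

Lemma ecc_attained v : exists w, dist v w = eccentricity v.
Proof.
rewrite /eccentricity.
have [|w ->] := @bigop.eq_bigmax G (dist v); first by apply/card_gt0P; exists v.
by exists w.
Qed.

Lemma dist_le_ecc v w : dist v w <= eccentricity v.
Proof. exact: leq_bigmax. Qed.

End Distance.

(** * Disjoint neighbourhoods and sums of distances *)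

Definition has_common_nbr (G : sgraph) (u v : G) :=
  [exists w, adj u w && adj v w].

Lemma common_nbr_dist (G : sgraph) (u v : G) : connected G ->
  has_common_nbr u v -> dist u v <= 2.
Proof.
move=> G_conn /existsP[w /andP[uw vw]].
apply: leq_trans (dist_triangle G_conn u w v) _.
by rewrite (@leq_add _ _ 1 1) // dist_adj // adj_sym.
Qed.

Lemma degree_sum_le (G : sgraph) (v : G) (us : seq G) delta :
  connected G -> (forall u : G, delta <= degree u) ->
  pairwise (fun u u' => ~~ has_common_nbr u u') us ->
  delta * \sum_(u <- us) (dist v u).-1 <= \sum_(w : G) dist v w.
Proof.
move=> G_conn deg_ge us_pw.
(* Disjointness: each [w] is charged to at most one member of [us], so exchanging the two sums below
   loses nothing. *)
have le_one w : \sum_(u <- us) adj u w <= 1.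
  elim: us us_pw => [|u us IH]; first by rewrite big_nil.
  rewrite pairwise_cons big_cons => /andP[/allP u_us /IH].
  case: (boolP (adj u w)) => // uw _; rewrite add1n ltnS leqn0.
  rewrite sum_nat_seq_eq0; apply/allP => u' /u_us.
  rewrite negb_exists => /forallP/(_ w); by rewrite uw /= => /negbTE->.
apply: (@leq_trans (\sum_(u <- us) \sum_(w : G) adj u w * dist v w)).
  rewrite big_distrr; apply: leq_sum => u _ /=.
  apply: (@leq_trans (degree u * (dist v u).-1)).
    by rewrite leq_mul2r deg_ge orbT.
  rewrite /degree cardsE -sum1_card big_distrl /= [leqRHS](bigID (adj u)) /=.
  apply: leq_trans (leq_addr _ _); apply: leq_sum => w uw.
  have {}uw : adj u w := uw.
  rewrite uw !mul1n.
  have := dist_triangle G_conn v w u.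
  by have := @dist_adj G w u; rewrite adj_sym => /(_ uw); lia.
rewrite exchange_big /=; apply: leq_sum => w _.
by rewrite -big_distrl /= -[leqRHS]mul1n leq_mul2r le_one orbT.
Qed.

(** * Selected levels on a geodesic *)

(* Only meaningful for [i <= d]: [d - i] is truncated. *)
Definition in_block d i := (d - i) %% 4 < 2.

(** Raising [d] by 4 keeps the selection up to level [d] and adds the levels [d + 3] and [d + 4],
    which contribute [(d + 2) + (d + 3)]. *)
Lemma in_block_step d L : L <= d.+3 ->
  \sum_(L <= i < d.+1 | in_block d i) i.-1 + (2 * d + 5)
  <= \sum_(L <= i < d.+4.+1 | in_block d.+4 i) i.-1.
Proof.
move=> le_L; rewrite big_mkcond [leqRHS]big_mkcond.
rewrite (@big_nat_recr _ _ _ d.+4 L) /=; last by lia.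
rewrite (@big_nat_recr _ _ _ d.+3 L) //=.
have -> : in_block d.+4 d.+4 by rewrite /in_block; lia.
have -> : in_block d.+4 d.+3 by rewrite /in_block; lia.
suff: \sum_(L <= i < d.+1) (if in_block d i then i.-1 else 0) <=
      \sum_(L <= i < d.+3) (if in_block d.+4 i then i.-1 else 0) by lia.
case: (leqP L d.+1) => [le_L'|?]; last by rewrite big_geq //; lia.
rewrite [leqRHS](@big_cat_nat _ _ _ d.+1) /=; try lia.
apply: leq_trans (leq_addr _ _); apply: eq_leq; apply: eq_big_nat => i i_d.
have -> // : in_block d.+4 i = in_block d i by rewrite /in_block; lia.
Qed.

(** Four times the increment [2 * d + 5] is exactly the growth of [d ^ 2 + d] from [d] to [d + 4].
    The constant 2 is attained at [d = 1] and [d = 2]. *)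
Lemma in_block_sum0 d :
  d ^ 2 + d <= 4 * (\sum_(0 <= i < d.+1 | in_block d i) i.-1) + 2.
Proof.
elim/ltn_ind: d => -[|[|[|[|d]]]] IH; try by rewrite !unlock.
have := @in_block_step d 0 isT; have := IH d ltac:(lia); nia.
Qed.

(** Same recursion, stopped once [d <= L], where the claim is trivial; [3 <= L] guarantees that
    [d - 4] is not truncated before that. *)
Lemma in_block_sum d L : 3 <= L ->
  d ^ 2 + d <= 4 * (\sum_(L <= i < d.+1 | in_block d i) i.-1) + (L ^ 2 + L).
Proof.
move=> L_ge3; elim/ltn_ind: d => d IH.
case: (leqP d L) => [|lt_Ld]; first by nia.
have [e d_e] : exists e, d = e.+4 by exists (d - 4); lia.
subst d; have := @in_block_step e L ltac:(lia); have := IH e ltac:(lia); nia.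
Qed.

Definition block_vertices (T : Type) (p : nat -> T) d L :=
  [seq p i | i <- index_iota L d.+1 & in_block d i].

Lemma mem_block_vertices (T : eqType) (p : nat -> T) d L u :
  u \in block_vertices p d L -> exists2 i, L <= i <= d & u = p i.
Proof.
by case/mapP=> i; rewrite mem_filter mem_index_iota ltnS => /andP[_ ?] ->; exists i.
Qed.

Lemma block_vertices_sum (G : sgraph) (v : G) (p : nat -> G) d L :
  (forall i, i <= d -> dist v (p i) = i) ->
  \sum_(u <- block_vertices p d L) (dist v u).-1 =
  \sum_(L <= i < d.+1 | in_block d i) i.-1.
Proof.
move=> p_dist; rewrite big_map big_filter big_nat_cond [RHS]big_nat_cond.
by apply: eq_bigr => i /andP[/andP[_ le_i] _]; rewrite p_dist.
Qed.

(** Two selected levels never differ by exactly 2, and a common neighbour forces a difference of at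
    most 2. Consecutive levels remain, where it would close a triangle. *)
Lemma block_vertices_pairwise (G : sgraph) (v : G) (p : nat -> G) d L :
  connected G -> triangle_free G ->
  (forall i, i < d -> adj (p i) (p i.+1)) ->
  (forall i, i <= d -> dist v (p i) = i) ->
  pairwise (fun u u' => ~~ has_common_nbr u u') (block_vertices p d L).
Proof.
move=> G_conn G_tf p_adj p_dist; rewrite pairwise_map.
pose P i := (i <= d) && in_block d i.
apply: (@sub_in_pairwise _ P ltn).
- move=> i k /andP[le_i i_d] /andP[le_k k_d] /= lt_ik.
  apply/negP => nbr.
  have := dist_triangle G_conn v (p i) (p k); rewrite !p_dist // => le_k_i.
  have k_i : k = i.+1.
    by have := common_nbr_dist G_conn nbr; move: i_d k_d; rewrite /in_block; lia.
  subst k; case/existsP: nbr => w /andP[iw kw].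
  have := G_tf (p i) (p i.+1) w; rewrite p_adj // kw adj_sym iw //.
- by apply/allP => i; rewrite mem_filter mem_index_iota /P ltnS => /and3P[-> _ ->].
apply: pairwise_filter; rewrite -sorted_pairwise; first exact: iota_ltn_sorted.
exact: ltn_trans.
Qed.

(** * The lower bound *)

(** [A] and [B] are the level sums of the two geodesics. If [r <= s + 5], the first has length at
    least [2 * r - 5] and [A] alone suffices. Otherwise [e >= r - s - 5], and what remains is
    [s ^ 2 - 5 * s + 6 * r - 50 >= 0]. *)
Lemma block_sums_ge (A B r s e : nat) : 14 < r -> r <= s + 5 + e ->
  (r + s) ^ 2 + (r + s) <= 4 * A + 2 ->
  e ^ 2 + e <= 4 * B + ((s + 7) ^ 2 + (s + 7)) ->
  2 * r ^ 2 + 12 <= 4 * (A + B) + 14 * r.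
Proof.
move=> r_gt14 e_ge A_ge B_ge; case: (leqP r (s + 5)) => [le_rs|lt_sr].
  have [t s_t] : exists t, s + 5 = r + t by exists (s + 5 - r); lia.
  have : (2 * r - 5) ^ 2 <= (r + s) ^ 2 by rewrite leq_sqr; lia.
  have [m r_m] : exists m, r = m + 15 by exists (r - 15); lia.
  subst r; have -> : 2 * (m + 15) - 5 = 2 * m + 25 by lia.
  by rewrite !expnS expn0 !muln1 in A_ge *; lia.
have [t r_t] : exists t, r = s + 5 + t by exists (r - (s + 5)); lia.
have t_e : t ^ 2 <= e ^ 2 by rewrite leq_sqr; lia.
have s_sq : s * 5 <= s * s + 7.
  case: (leqP s 5) => [|/ltnW s_ge5].
    by case: s {A_ge B_ge e_ge lt_sr r_t} => [|[|[|[|[|[]]]]]].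
  by apply: leq_trans (leq_addr _ _); rewrite leq_mul2l s_ge5 orbT.
by subst r; rewrite !expnS expn0 !muln1 in A_ge B_ge t_e *; lia.
Qed.

(** Free of subtraction, this says that the distance sum is at least
    [delta / 2 * (r ^ 2 - 7 * r + 6)], slightly more than the required [47 / 8]. *)
Lemma transmission_ge (G : sgraph) (v : G) delta r :
  connected G -> triangle_free G -> (forall u : G, delta <= degree u) ->
  (forall u : G, r <= eccentricity u) -> 0 < r ->
  delta * (2 * r ^ 2 + 12) <= 4 * (\sum_(w : G) dist v w) + delta * (14 * r).
Proof.
move=> G_conn G_tf deg_ge ecc_ge r_gt0.
have [x dist_x] := ecc_attained v.
have [p [p0 px p_adj p_dist]] := geodesic G_conn v x.
have le_rd := ecc_ge v; rewrite -dist_x in le_rd.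
have x_max w : dist v w <= dist v x by rewrite dist_x dist_le_ecc.
move: (dist v x) le_rd x_max p_adj p_dist px.
move=> d le_rd x_max p_adj p_dist px {dist_x}.
set sigma := \sum_(w : G) _.
have P_pw := block_vertices_pairwise 0 G_conn G_tf p_adj p_dist.
have P_sum := block_vertices_sum 0 p_dist.
have A_ge := in_block_sum0 d.
have sigma_geP := degree_sum_le v G_conn deg_ge P_pw.
rewrite P_sum in sigma_geP.
suff [S delta_S S_ge] : exists2 S,
    delta * S <= sigma & 2 * r ^ 2 + 12 <= 4 * S + 14 * r.
  by have := leq_mul (leqnn delta) S_ge; lia.
(* With only [d >= r], [A_ge] leaves [(r - 1) * (r - 14) <= 0] to check, hence the threshold 14. *)
case: (leqP r 14) => r_14.
  by eexists; first exact: sigma_geP; nia.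
have [s d_s] : exists s, d = r + s by exists (d - r); lia.
have [y dist_y] := ecc_attained (p (s + 5)).
have [q [q0 qy q_adj q_dist]] := geodesic G_conn v y.
have le_ed := x_max y.
have e_ge : r <= s + 5 + dist v y.
  rewrite -[in leqRHS](p_dist (s + 5)); last by lia.
  rewrite [dist v (p _)](dist_sym G_conn).
  by apply: leq_trans (dist_triangle G_conn _ v _); rewrite dist_y.
have r_y : r <= dist (p (s + 5)) y by rewrite dist_y.
move: (dist v y) le_ed q_adj q_dist qy e_ge.
move=> e le_ed q_adj q_dist qy e_ge.
have Q_pw := block_vertices_pairwise (s + 7) G_conn G_tf q_adj q_dist.
have Q_sum := block_vertices_sum (s + 7) q_dist.
have B_ge := @in_block_sum e (s + 7) ltac:(lia).
exists (\sum_(0 <= i < d.+1 | in_block d i) i.-1 +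
        \sum_(s + 7 <= i < e.+1 | in_block e i) i.-1); last first.
  by subst d; apply: block_sums_ge A_ge B_ge; lia.
rewrite -P_sum -Q_sum -big_cat; apply: degree_sum_le => //.
rewrite pairwise_cat P_pw Q_pw !andbT; apply/allrelP => u w.
case/mem_block_vertices=> k /andP[_ le_k] ->.
case/mem_block_vertices=> l /andP[l_ge le_l] ->.
(* Here [l >= s + 7] gives [k >= s + 5], so [p k] lies beyond [p (s + 5)]. Going via [p k] and
   [q l], the distance from [p (s + 5)] to [y] is at most [(k - s - 5) + 2 + (e - l) <= e - s - 1 <
   r], using [k <= l + 2] and [e <= r + s]. *)
apply/negP => /(common_nbr_dist G_conn) dist_kl.
have := dist_triangle G_conn v (p k) (q l).
rewrite q_dist // p_dist // => l_le.
have := dist_path G_conn p_adj (i := s + 5) (k := k - (s + 5)).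
rewrite subnKC; last by lia.
move=> /(_ le_k) k_le.
have := dist_path G_conn q_adj (i := l) (k := e - l).
rewrite subnKC // qy => /(_ (leqnn _)) l_y.
have := dist_triangle G_conn v (q l) (p k).
rewrite q_dist // p_dist // [dist (q l) _](dist_sym G_conn) => k_le'.
have := dist_triangle G_conn (p (s + 5)) (p k) y.
have := dist_triangle G_conn (p k) (q l) y.
lia.
Qed.

Lemma radius_le_ecc (G : sgraph) (u : G) : radius G <= eccentricity u.
Proof. by rewrite -leEnat; apply: fmin_le. Qed.

Lemma min_degree_le (G : sgraph) (u : G) : min_degree G <= degree u.
Proof. by rewrite -leEnat; apply: fmin_le. Qed.

Lemma proximity_lower_bound (n delta r : nat) (G : sgraph) :
  1 <= r -> 2 <= n -> connected G -> triangle_free G ->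
  #|G| = n -> min_degree G = delta -> radius G = r ->
  (proximity_bound n delta r <= proximity G)%R.
Proof.
move=> r_gt0 n_gt1 G_conn G_tf G_n G_delta G_r.
rewrite /proximity.
have [|v <-] := fmin_attained 0%R (@avg_dist G); first by rewrite G_n; lia.
rewrite /avg_dist /proximity_bound G_n.
rewrite -G_r in r_gt0.
have := transmission_ge v G_conn G_tf (@min_degree_le G) (@radius_le_ecc G) r_gt0.
rewrite G_delta G_r.
move: (\sum_(w : G) _) => S.
rewrite -(ler_nat rat) !(natrD, natrM, natrX) => S_ge.
have n1_gt0 : (0 < n%:R - 1 :> rat)%R by rewrite subr_gt0 ltr1n.
have -> : (delta%:R / (2 * (n%:R - 1)) * (r%:R ^+ 2 - 7 * r%:R + 47 / 8) =
  delta%:R / 2 * (r%:R ^+ 2 - 7 * r%:R + 47 / 8) / (n%:R - 1) :> rat)%R.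
  by field; rewrite gt_eqF.
rewrite ler_pM2r ?invr_gt0 //.
have : (0 <= delta%:R :> rat)%R by [].
nra.
Qed.

(** Gives lower bounds on distances in the example without classifying its walks. *)
Lemma lipschitz_le_dist (G : sgraph) (g : G -> nat) u v :
  connected G -> (forall x y, adj x y -> g y <= (g x).+1) ->
  g v <= g u + dist u v.
Proof.
move=> G_conn g_lip; have [p [up <- <-]] := dist_attained (G_conn u v).
elim: p u up => [|w p IH] u /=; first by rewrite addn0.
by case/andP=> /g_lip uw /IH; lia.
Qed.

(** * Blowups: vertices replaced by independent sets *)

Section Blowup.
Variables (T : finType) (e : rel T) (s : T -> nat).
Hypotheses (e_sym : symmetric e) (e_irr : irreflexive e).

Definition blowup_vertex := {c : T & 'I_(s c)}.
Definition blowup_adj : rel blowup_vertex := fun x y => e (tag x) (tag y).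

Lemma blowup_adj_sym : symmetric blowup_adj.
Proof. by move=> x y; apply: e_sym. Qed.

Lemma blowup_adj_irr : irreflexive blowup_adj.
Proof. by move=> x; apply: e_irr. Qed.

Definition blowup : sgraph := SGraph blowup_adj_sym blowup_adj_irr.

Lemma blowup_sum (P : pred T) (F : T -> nat) :
  \sum_(x : blowup | P (tag x)) F (tag x) = \sum_(c | P c) s c * F c.
Proof.
(* The dummy conjunct gives the predicate the dependent-pair shape that [sig_big_dep] expects. *)
rewrite (eq_bigl (fun x : blowup => P (tag x) && true)); last first.
  by move=> x; rewrite andbT.
rewrite -(@sig_big_dep _ _ _ T (fun c => 'I_(s c)) P (fun _ => xpredT)
            (fun c _ => F c)).
by apply: eq_bigr => c _; rewrite sum_nat_const card_ord.
Qed.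

Lemma card_blowup : #|blowup| = \sum_c s c.
Proof.
rewrite -sum1_card (eq_bigl xpredT) // (blowup_sum xpredT (fun _ => 1)).
by apply: eq_bigr => c _; rewrite muln1.
Qed.

Lemma degree_blowup (x : blowup) : degree x = \sum_(c | e (tag x) c) s c.
Proof.
rewrite /degree cardsE -sum1_card (blowup_sum (e (tag x)) (fun _ => 1)).
by apply: eq_bigr => c _; rewrite muln1.
Qed.

Lemma blowup_triangle_free :
  (forall a b c, ~~ [&& e a b, e b c & e c a]) -> triangle_free blowup.
Proof. by move=> e_tf x y z; apply: e_tf. Qed.

End Blowup.

(** * Cycles and periodic class sizes *)

Definition cycle_adj N : rel 'I_N := fun i j =>
  [|| i.+1 == j, j.+1 == i, (i == 0 :> nat) && (j.+1 == N)
    | (j == 0 :> nat) && (i.+1 == N)].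

Lemma cycle_adj_sym N : symmetric (@cycle_adj N).
Proof. by move=> i j; rewrite /cycle_adj; apply/idP/idP; lia. Qed.

Lemma cycle_adj_irr N : 1 < N -> irreflexive (@cycle_adj N).
Proof. by move=> N_gt1 i; apply/negbTE; rewrite /cycle_adj; lia. Qed.

(** Around a cycle of length divisible by 4, each class lies between one of size 1 and one of size
    [D - 1], so all degrees are [D]. *)
Definition block_size D i := if i %% 4 < 2 then 1 else D.-1.

Lemma block_size_four D k :
  [/\ block_size D (4 * k) = 1, block_size D (4 * k).+1 = 1,
      block_size D (4 * k).+2 = D.-1 & block_size D (4 * k).+3 = D.-1].
Proof. by rewrite /block_size; split; case: ifP => //; lia. Qed.

Lemma sum_block_size D k : 0 < D ->
  \sum_(0 <= i < 4 * k) block_size D i = 2 * k * D.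
Proof.
move=> D_gt0; elim: k => [|k IH]; first by rewrite big_geq.
rewrite [4 * k.+1](_ : _ = (4 * k).+4); last by lia.
rewrite !big_nat_recr //= IH.
have [-> -> -> ->] := block_size_four D k; lia.
Qed.

(** From [k] to [k + 2], four classes are added at each end and every old class moves 4 further
    away. The sum grows by [8 * k * D + 8 * D], exactly as [2 * D * k ^ 2] does; the extra [D]
    absorbs the case [k = 1]. *)
Lemma sum_block_size_dist D k : 0 < D ->
  \sum_(0 <= i < 4 * k) block_size D i * minn i (4 * k - i) <=
  2 * D * k ^ 2 + D.
Proof.
move=> D_gt0; elim/ltn_ind: k => -[|[|k]] IH; first by rewrite big_geq.
  by rewrite unlock /= /block_size /=; lia.
have {IH} := IH k ltac:(lia).
set S := \sum_(0 <= i < _) _ => S_le.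
rewrite [4 * k.+2](_ : _ = (4 * k).+4.+4); last by lia.
do 4!rewrite big_nat_recr //=.
do 4!rewrite big_nat_recl //=.
have -> : \sum_(0 <= i < 4 * k) block_size D i.+4 *
    minn i.+4 ((4 * k).+4.+4 - i.+4) = 2 * k * D * 4 + S.
  rewrite -(sum_block_size k D_gt0) big_distrl -big_split /=.
  apply: eq_big_nat => i i_k; rewrite -mulnDr; congr (_ * _); lia.
have [E0 E1 E2 E3] := block_size_four D k.+1.
rewrite [4 * k.+1](_ : _ = (4 * k).+4) in E0 E1 E2 E3; last by lia.
have [F0 F1 F2 F3] : [/\ block_size D 0 = 1, block_size D 1 = 1,
  block_size D 2 = D.-1 & block_size D 3 = D.-1] := block_size_four D 0.
rewrite {}E0 {}E1 {}E2 {}E3 {}F0 {}F1 {}F2 {}F3.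
have head_min i : i < 4 -> minn i ((4 * k).+4.+4 - i) = i by lia.
rewrite (head_min 0) // (head_min 1) // (head_min 2) // (head_min 3) //.
have -> : minn (4 * k).+4 ((4 * k).+4.+4 - (4 * k).+4) = 4 by lia.
have -> : minn (4 * k).+1.+4 ((4 * k).+4.+4 - (4 * k).+1.+4) = 3 by lia.
have -> : minn (4 * k).+2.+4 ((4 * k).+4.+4 - (4 * k).+2.+4) = 2 by lia.
have -> : minn (4 * k).+3.+4 ((4 * k).+4.+4 - (4 * k).+3.+4) = 1 by lia.
rewrite !expnS expn0 !muln1 in S_le *.
lia.
Qed.

(** For [N > 2] the cyclic successor and predecessor are distinct, so each gives its own term. *)
Lemma sum_cycle_adj N (s : nat -> nat) (i : 'I_N) : 2 < N ->
  \sum_(j | cycle_adj i j) s j =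
  s (if i.+1 == N then 0 else i.+1) + s (if i == 0 :> nat then N.-1 else i.-1).
Proof.
move=> N_gt2; have i_N := ltn_ord i.
have nxt_N : (if i.+1 == N then 0 else i.+1) < N by case: eqP; lia.
have prv_N : (if i == 0 :> nat then N.-1 else i.-1) < N by case: eqP; lia.
rewrite (bigD1 (Ordinal nxt_N)) /=; last by rewrite /cycle_adj /=; case: ifP; lia.
rewrite (bigD1 (Ordinal prv_N)) /=; last first.
  by rewrite /cycle_adj -val_eqE /=; do 2!case: ifP; lia.
rewrite big1 ?addn0 // => j; have := ltn_ord j.
by rewrite /cycle_adj -!val_eqE /=; do 2!case: ifP; lia.
Qed.

(** * The extremal graphs *)

Section CycleBlowup.
Variables D k : nat.
Hypotheses (D_gt1 : 1 < D) (k_gt0 : 0 < k).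

Let N_gt1 : 1 < 4 * k.
Proof. by rewrite (leq_trans (_ : 1 < 4 * 1)) // leq_mul2l. Qed.

Definition cycle_blowup : sgraph :=
  blowup (fun c : 'I_(4 * k) => block_size D c)
    (@cycle_adj_sym (4 * k)) (cycle_adj_irr N_gt1).

Let cls (x : cycle_blowup) : 'I_(4 * k) := tag x.

Lemma block_size_gt0 i : 0 < block_size D i.
Proof. by rewrite /block_size; case: ifP; lia. Qed.

Lemma card_cycle_blowup : #|cycle_blowup| = 2 * k * D.
Proof.
rewrite card_blowup -(big_mkord xpredT (block_size D)) sum_block_size //; lia.
Qed.

Lemma degree_cycle_blowup (x : cycle_blowup) : degree x = D.
Proof.
rewrite degree_blowup (sum_cycle_adj (block_size D)); last by lia.
by have := ltn_ord (tag x); rewrite /block_size; do 4!case: ifP; lia.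
Qed.

Lemma cycle_blowup_triangle_free : triangle_free cycle_blowup.
Proof. by apply: blowup_triangle_free => a b c; rewrite /cycle_adj; lia. Qed.

Lemma cycle_blowup_class i : i < 4 * k -> exists x, cls x = i :> nat.
Proof.
move=> i_N; pose c := Ordinal i_N.
by exists (Tagged (fun c : 'I_(4 * k) => 'I_(block_size D c))
             (Ordinal (block_size_gt0 c))).
Qed.

(** Class 0 is a singleton, which starts the induction on cyclic distance in the path
    construction. *)
Lemma cycle_blowup_class0 x y : cls x = 0 :> nat -> cls y = 0 :> nat -> x = y.
Proof.
case: x => [[c c_N] i]; case: y => [[c' c'_N] i'] /= c0 c'0; subst c c'.
move: i i'; rewrite (bool_irrelevance c_N c'_N) => i i'.
by rewrite [i]ord1 [i']ord1.
Qed.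

Lemma cycle_blowup_path x y : cls x = 0 :> nat ->
  exists p, [/\ path (@adj cycle_blowup) x p, last x p = y &
                size p = minn (cls y) (4 * k - cls y)].
Proof.
move=> x0; have [m] := ubnPeq (minn (cls y) (4 * k - cls y)).
elim: m y => [|m IH] y y_m; have y_N := ltn_ord (cls y).
  have <- : x = y by apply: cycle_blowup_class0 => //; lia.
  by exists [::].
pose j := cls y : nat.
(* [z] lies one class closer to class 0 along the shorter arc, wrapping around from [4 * k - 1] to
   0. *)
have [|z z_y] := @cycle_blowup_class
  (if j <= 2 * k then j.-1 else if j.+1 == 4 * k then 0 else j.+1).
  by rewrite /j; do !case: ifP; lia.
have [|p [xp pz p_size]] := IH z.
  by rewrite z_y /j; do !case: ifP; lia.
exists (rcons p y); split; last 2 first.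
- by rewrite last_rcons.
- by rewrite size_rcons p_size.
rewrite rcons_path xp pz /= /blowup_adj -/(cls z) -/(cls y) /cycle_adj z_y /j.
by do !case: ifP; lia.
Qed.

Lemma cycle_blowup_connected : connected cycle_blowup.
Proof.
have [|x0 x0_0] := @cycle_blowup_class 0; first by lia.
have conn0 y : connect (@adj cycle_blowup) x0 y.
  by have [p [xp <- _]] := cycle_blowup_path y x0_0; apply/connectP; exists p.
move=> x y; apply: connect_trans (conn0 y).
by rewrite (sym_connect_sym (@adj_sym cycle_blowup)).
Qed.

Lemma dist_cycle_blowup0 x y : cls x = 0 :> nat ->
  dist x y <= minn (cls y) (4 * k - cls y).
Proof.
by move=> x0; have [p [xp <- <-]] := cycle_blowup_path y x0; apply: dist_min.
Qed.

(** The witness is a vertex in the antipodal class. *)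
Lemma ecc_cycle_blowup_ge (x : cycle_blowup) : 2 * k <= eccentricity x.
Proof.
have x_N := ltn_ord (cls x).
have [|y y_x] := @cycle_blowup_class
  (if cls x < 2 * k then cls x + 2 * k else cls x - 2 * k).
  by case: ifP; lia.
apply: leq_trans (dist_le_ecc x y).
(* Cyclic distance from the class of [x]; the sum of the two truncated differences is an absolute
   difference. *)
pose g (z : cycle_blowup) := minn ((cls z - cls x) + (cls x - cls z))
                                  (4 * k - ((cls z - cls x) + (cls x - cls z))).
have := @lipschitz_le_dist _ g x y cycle_blowup_connected.
have -> : g x = 0 by rewrite /g; lia.
have -> : g y = 2 * k by rewrite /g y_x; case: ifP; lia.
rewrite add0n; apply=> a b; have := ltn_ord (cls a); have := ltn_ord (cls b).
rewrite /g /= /blowup_adj /cycle_adj -/(cls a) -/(cls b).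
lia.
Qed.

Lemma radius_cycle_blowup : radius cycle_blowup = 2 * k.
Proof.
have [|x0 x0_0] := @cycle_blowup_class 0; first by lia.
apply/eqP; rewrite eqn_leq; apply/andP; split.
  apply: leq_trans (radius_le_ecc x0) _; apply/bigmax_leqP => y _.
  by apply: leq_trans (dist_cycle_blowup0 y x0_0) _; lia.
rewrite /radius; have [|x <-] := fmin_attained 0 (@eccentricity cycle_blowup).
  by apply/card_gt0P; exists x0.
exact: ecc_cycle_blowup_ge.
Qed.

Lemma min_degree_cycle_blowup : min_degree cycle_blowup = D.
Proof.
rewrite /min_degree; have [|x <-] := fmin_attained 0 (@degree cycle_blowup).
  by rewrite card_cycle_blowup; lia.
exact: degree_cycle_blowup.
Qed.

Lemma transmission_cycle_blowup x : cls x = 0 :> nat ->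
  \sum_(y : cycle_blowup) dist x y <= 2 * D * k ^ 2 + D.
Proof.
move=> x0; apply: leq_trans (sum_block_size_dist k (ltnW D_gt1)).
rewrite big_mkord.
rewrite -(blowup_sum (fun c : 'I_(4 * k) => block_size D c)
            (@cycle_adj_sym (4 * k)) (cycle_adj_irr N_gt1) xpredT
            (fun c : 'I_(4 * k) => minn c (4 * k - c))).
by apply: leq_sum => y _; apply: dist_cycle_blowup0.
Qed.

(** After multiplication by [n - 1 = 2 * k * D - 1] the quadratic terms cancel. A gap of at most
    [7 * k * D - 31 / 16 * D] remains, which [8 * (n - 1)] covers. *)
Lemma proximity_cycle_blowup :
  (proximity cycle_blowup <= proximity_bound (2 * k * D) D (2 * k) + 8)%R.
Proof.
have [|x x_0] := @cycle_blowup_class 0; first by lia.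
apply: (le_trans (fmin_le 0%R (@avg_dist cycle_blowup) x)).
rewrite /avg_dist /proximity_bound card_cycle_blowup.
have := transmission_cycle_blowup x_0.
move: (\sum_(w : cycle_blowup) _) => S.
rewrite -(ler_nat rat) !(natrD, natrM, natrX) => S_le.
have k_ge1 : (1 <= k%:R :> rat)%R by rewrite ler1n.
have D_ge2 : (2 <= D%:R :> rat)%R by rewrite ler_nat.
move: (S%:R : rat)%R (k%:R : rat)%R (D%:R : rat)%R S_le k_ge1 D_ge2.
move=> {}S K E S_le K_ge1 E_ge2.
have n1_gt0 : (0 < 2 * K * E - 1)%R by nra.
rewrite ler_pdivrMr // mulrDl.
have -> : (E / (2 * (2 * K * E - 1)) *
    ((2 * K) ^+ 2 - 7 * (2 * K) + 47 / 8) * (2 * K * E - 1) =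
  E / 2 * ((2 * K) ^+ 2 - 7 * (2 * K) + 47 / 8))%R.
  by field; rewrite gt_eqF.
nra.
Qed.

End CycleBlowup.

Theorem theorem5p2 :
  (forall (n delta r : nat) (G : sgraph),
     3 <= delta -> 1 <= r -> 6 <= n ->
     connected G -> triangle_free G ->
     #|G| = n -> min_degree G = delta -> radius G = r ->
     (proximity_bound n delta r <= proximity G)%R)
  /\
  (exists c : rat, forall delta : nat, 3 <= delta ->
     forall r0 n0 : nat, exists (r n : nat) (G : sgraph),
       (r0 <= r /\ n0 <= n) /\
       (connected G /\ triangle_free G) /\
       (#|G| = n /\ min_degree G = delta /\ radius G = r) /\
       (proximity G <= proximity_bound n delta r + c)%R).
Proof.
split=> [n delta r G _ r_gt0 n_ge6|]; first by apply: proximity_lower_bound; lia.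
exists 8%R => delta delta_ge3 r0 n0.
have delta_gt1 : 1 < delta by lia.
(* One [k] exceeding both [r0] and [n0] makes radius and order large together. *)
pose k := (r0 + n0).+1; have k_gt0 : 0 < k by [].
exists (2 * k), (2 * k * delta), (cycle_blowup delta k_gt0).
split; first by rewrite /k; split; nia.
split.
  by split; [apply: cycle_blowup_connected | apply: cycle_blowup_triangle_free].
split; last exact: proximity_cycle_blowup.
by rewrite card_cycle_blowup ?min_degree_cycle_blowup ?radius_cycle_blowup.
Qed.
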